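(* Let $G=(V,E)$ be a finite undirected simple unweighted $D$-regular graph with $N$ vertices, and let $-\sigma_{\mathrm{triv}}:E^{or}\to\{-1\}\subset O(1)$ be the signature that is constantly $-1$. Assume that $G$ satisfies $CD^{-\sigma_{\mathrm{triv}}}(0,\infty)$. Then the largest eigenvalue $\lambda_N$ of $-\Delta$, where $\Delta$ is the graph Laplacian, satisfies $$2-\lambda_N\le 16(\log 2)\,D\,(h_1^{-\sigma_{\mathrm{triv}}})^2 .$$
   Context: Let $D\ge1$. Write $x\sim y$ if $\{x,y\}\in E$, and $E^{or}=\{(x,y),(y,x)\mid\{x,y\}\in E\}$. The graph Laplacian is $\Delta u(x)=\frac1D\sum_{y\sim x}(u(y)-u(x))$ for $u:V\to\mathbb{R}$; the eigenvalues of $-\Delta$ are $0=\lambda_1\le\cdots\le\lambda_N\le2$. For a signature $\sigma:E^{or}\to O(1)=\{\pm1\}$ with $\sigma_{yx}=\sigma_{xy}^{-1}$, put $\Delta^\sigma f(x)=\frac1D\sum_{y\sim x}(\sigma_{xy}f(y)-f(x))$ for $f:V\to\mathbb{R}$. For $f,g:V\to\mathbb{R}$ define $2\Gamma^\sigma(f,g)=\Delta(fg)-f\,\Delta^\sigma g-(\Delta^\sigma f)\,g$ and $2\Gamma_2^\sigma(f,g)=\Delta\Gamma^\sigma(f,g)-\Gamma^\sigma(f,\Delta^\sigma g)-\Gamma^\sigma(\Delta^\sigma f,g)$. $CD^\sigma(0,\infty)$ means $\Gamma_2^\sigma(f,f)(x)\ge0$ for all $f:V\to\mathbb{R}$, $x\in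 V$. For $\emptyset\neq S\subseteq V$ let $E_S$ be the edge set of the induced subgraph of $S$, $\iota^\sigma(S)=\min_{\tau:S\to\{\pm1\}}\sum_{\{x,y\}\in E_S}|\sigma_{xy}\tau(y)-\tau(x)|$, $|E(S,V\setminus S)|$ the number of edges between $S$ and $V\setminus S$, and $\phi^\sigma(S)=\frac{\iota^\sigma(S)+|E(S,V\setminus S)|}{D\,|S|}$. Then $h_1^\sigma=\min_{\emptyset\ne S\subseteq V}\phi^\sigma(S)$. *)

(* Defs.v *)
From HB Require Import structures.
From mathcomp Require Import all_boot all_order all_algebra.
From mathcomp Require Import reals exp.

Set Implicit Arguments.
Unset Strict Implicit.
Unset Printing Implicit Defensive.

Import Order.TTheory GRing.Theory Num.Theory.
Local Open Scope ring_scope.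

(* A finite simple graph is given by its adjacency relation [e] on a finite
   vertex type [V]. *)
Definition simple_graph (V : finType) (e : rel V) : Prop :=
  symmetric e /\ irreflexive e.

Definition regular_graph (V : finType) (e : rel V) (D : nat) : Prop :=
  forall x : V, #|[set y | e x y]| = D.

Section Signature.
Variables (R : realType) (V : finType) (e : rel V).

(* Signatures are stored as total real-valued functions; only the values on
   oriented edges, which have to be 1 or -1, are ever used. *)
Definition is_signature (sigma : V -> V -> R) : Prop :=
  forall x y, e x y ->
    (sigma x y = 1 \/ sigma x y = -1) /\ sigma y x = (sigma x y)^-1.

Definition neg_triv_sig : V -> V -> R := fun _ _ => -1.

Lemma neg_triv_sigP : is_signature neg_triv_sig.
Proof. by move=> x y _; split; [right | rewrite /neg_triv_sig invrN1]. Qed.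

End Signature.

Section Operators.
Variables (R : realType) (V : finType) (e : rel V) (D : nat).
Variable sigma : V -> V -> R.
Implicit Types f g u : V -> R.

Definition laplacian u : V -> R :=
  fun x => D%:R^-1 * \sum_(y | e x y) (u y - u x).

Definition sig_laplacian f : V -> R :=
  fun x => D%:R^-1 * \sum_(y | e x y) (sigma x y * f y - f x).

Definition Gamma f g : V -> R :=
  fun x => 2^-1 * (laplacian (fun z => f z * g z) x
                   - f x * sig_laplacian g x - sig_laplacian f x * g x).

Definition Gamma2 f g : V -> R :=
  fun x => 2^-1 * (laplacian (Gamma f g) x
                   - Gamma f (sig_laplacian g) x
                   - Gamma (sig_laplacian f) g x).

(* CD^sigma(0, oo) *)
Definition CD_0_oo : Prop := forall f x, 0 <= Gamma2 f f x.

(* lambda is an eigenvalue of - laplacian *)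
Definition is_eigenvalue (lambda : R) : Prop :=
  exists f, (exists x, f x != 0) /\
    forall x, - laplacian f x = lambda * f x.

Definition is_largest_eigenvalue (lambda : R) : Prop :=
  is_eigenvalue lambda /\ forall mu, is_eigenvalue mu -> mu <= lambda.

End Operators.

Section Cheeger.
Variables (R : realType) (V : finType) (e : rel V) (D : nat).
Variable sigma : V -> V -> R.
Implicit Types S : {set V}.

(* A map tau : S -> {1, -1} is encoded by booleans, tau(x) = (-1) ^+ tau x,
   and extended arbitrarily to V: only its values on S occur below.  Each edge
   {x, y} of the induced subgraph is counted as (x, y) and as (y, x), with the
   same value when sigma is a signature, whence the factor 1/2. *)
Definition frustration S (tau : {ffun V -> bool}) : R :=
  2^-1 * \sum_(x in S) \sum_(y in S | e x y)
    `|sigma x y * (-1) ^+ tau y - (-1) ^+ tau x|.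

(* The initial value of this minimum is one of the values minimized. *)
Definition frustration_index S : R :=
  \big[Num.min/frustration S [ffun=> false]]_(tau : {ffun V -> bool})
    frustration S tau.

Definition boundary_size S : nat :=
  #|[set p : V * V | [&& p.1 \in S, p.2 \notin S & e p.1 p.2]]|.

Definition phi S : R :=
  (frustration_index S + (boundary_size S)%:R) / (D%:R * #|S|%:R).

(* For nonempty V the initial value [phi setT] is one of the values minimized;
   for empty V there is nothing to minimize over. *)
Definition cheeger1 : R :=
  \big[Num.min/phi [set: V]]_(S : {set V} | S != set0) phi S.

End Cheeger.

(* Main.v *)
Require Import Defs.
From HB Require Import structures.
From mathcomp Require Import all_boot all_order all_algebra.
From mathcomp Require Import ring lra.
From mathcomp Require classical_sets.
From mathcomp Require Import reals exp.

(** Write L for minus the signed Laplacian.  The classical argument of Buser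
    type runs the heat semigroup of L: nonnegative curvature makes the gradient
    of the heat flow at time t at most (2t)^(-1/2), hence a signed indicator
    of a set S moves by at most a multiple of sqrt t times its variation, while the spectral
    gap lam forces it to decay like exp(- lam t); comparing the two at time
    t = ln 2 / lam bounds lam by the square of the Cheeger quotient of S.

    Here the semigroup is replaced by its implicit Euler scheme: the iterates
    F (k+1) = (1 + s L)^-1 (F k).  For the implicit scheme each error term of
    second order in s has the favourable sign, so the exact inequalities of
    the continuous argument hold without a limit.  The curvature condition
    gives (1 - s Delta) Gamma(F (k+1)) <= Gamma(F k), and therefore
    F k ^ 2 + 2 s k Gamma(F (k+1)) stays below the initial bound by
    the maximum principle: this is the gradient estimate
    [resolvent_energy_le1].  Pairing the telescoping sum of the F k - F (k+1)
    with F 0 and integrating by parts turns it into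
    [spectral_variation],
      (1 - (1 + s lam)^-m) |g|^2
        <= (3/2 + 2 sqrt m) sqrt (s D) Var(g) / (2 D),
    in which the sum of the 1 / sqrt k replaces the integral of (2t)^(-1/2).

    The number 16 ln 2 comes from stopping at time (ln 2) / lam, whereas the
    best time is about 1.25 / lam.  The slack between the two absorbs the
    discretization error, so finitely many steps are enough
    ([quadratic_of_decay]) and the only fact needed on the logarithm is
    ln 2 >= 2/3.

    For the constant signature -1 one has L = 2 + Delta, so the
    spectral gap of L is 2 - lambda_N, once it is known that the largest
    eigenvalue bounds the Rayleigh quotient ([rayleigh_le]). *)

Set Implicit Arguments.
Unset Strict Implicit.
Unset Printing Implicit Defensive.

Import Order.TTheory GRing.Theory Num.Theory.
Local Open Scope ring_scope.

(** * Quadratic forms of symmetric kernels on a finite set *)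

Section Kernels.
Variables (R : realType) (V : finType).
Implicit Types (A B : V -> V -> R) (u v w : V -> R).

Definition ip u v : R := \sum_x u x * v x.

(** The operator with kernel [A]; stating the linear algebra for functions on
    [V] rather than for matrices avoids an enumeration of the vertices. *)
Definition kapp A u : V -> R := fun x => \sum_y A x y * u y.

Lemma ipC u v : ip u v = ip v u.
Proof. by apply: eq_bigr => x _; rewrite mulrC. Qed.

Lemma eq_ip u u' v v' : u =1 u' -> v =1 v' -> ip u v = ip u' v'.
Proof. by move=> hu hv; apply: eq_bigr => x _; rewrite hu hv. Qed.

Lemma ip_linl (a b : R) u v w :
  ip (fun x => a * u x + b * v x) w = a * ip u w + b * ip v w.
Proof.
rewrite /ip !mulr_sumr -big_split; apply: eq_bigr => x _ /=; ring.
Qed.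

Lemma ip_ge0 u : 0 <= ip u u.
Proof. by apply: sumr_ge0 => x _; rewrite -expr2 sqr_ge0. Qed.

Lemma ip_eq0 u : ip u u = 0 -> forall x, u x = 0.
Proof.
move=> /psumr_eq0P h x.
have /eqP := h (fun y _ => sqr_ge0 (u y)) x isT.
by rewrite mulf_eq0 orbb => /eqP.
Qed.

Lemma ip_young (r : R) u v : 0 < r -> 2 * ip u v <= r * ip u u + r^-1 * ip v v.
Proof.
move=> r0; rewrite /ip !mulr_sumr -big_split; apply: ler_sum => x _ /=.
rewrite -subr_ge0.
have -> : r * (u x * u x) + r^-1 * (v x * v x) - 2 * (u x * v x)
   = r^-1 * (r * u x - v x) ^+ 2 by field; rewrite gt_eqF.
by rewrite mulr_ge0 ?sqr_ge0 // invr_ge0 ltW.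
Qed.

Lemma sqr_le_ip u x : u x ^+ 2 <= ip u u.
Proof.
rewrite /ip (bigD1 x) //= expr2 lerDl.
by apply: sumr_ge0 => y _; rewrite -expr2 sqr_ge0.
Qed.

Lemma kapp_lin A (a b : R) u v x :
  kapp A (fun y => a * u y + b * v y) x = a * kapp A u x + b * kapp A v x.
Proof.
rewrite /kapp !mulr_sumr -big_split; apply: eq_bigr => y _ /=; ring.
Qed.

Lemma kapp_adj A u v : ip (kapp A u) v = ip u (kapp (fun x y => A y x) v).
Proof.
rewrite /ip /kapp.
under eq_bigr do rewrite mulr_suml.
rewrite exchange_big; apply: eq_bigr => x _ /=; rewrite mulr_sumr.
by apply: eq_bigr => y _; ring.
Qed.

Lemma kapp_sym A u v : (forall x y, A x y = A y x) ->
  ip (kapp A u) v = ip u (kapp A v).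
Proof.
move=> hA; rewrite kapp_adj; apply: eq_ip => // x.
by apply: eq_bigr => y _; rewrite hA.
Qed.

Definition kabs A : R := \sum_x \sum_y `|A x y|.

Lemma kabs_ge0 A : 0 <= kabs A.
Proof. by apply: sumr_ge0 => x _; apply: sumr_ge0. Qed.

Lemma ip_kapp_le A u : ip (kapp A u) u <= kabs A * ip u u.
Proof.
rewrite /kabs mulr_suml; apply: ler_sum => x _.
rewrite /kapp !mulr_suml; apply: ler_sum => y _.
apply: le_trans (ler_norm _) _; rewrite -mulrA normrM ler_wpM2l //.
have := sqr_le_ip u x; have := sqr_le_ip u y.
have := sqr_ge0 (u x - u y); have := sqr_ge0 (u x + u y).
by move=> *; rewrite ler_norml; apply/andP; split; nra.
Qed.

(** Transport of the fact that an injective square matrix is invertible. *)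
Lemma kernel_inverse A : (forall u, kapp A u =1 (fun=> 0) -> u =1 (fun=> 0)) ->
  exists B, (forall u, kapp A (kapp B u) =1 u)
         /\ (forall u, kapp B (kapp A u) =1 u).
Proof.
move=> hinj; pose n := #|V|.
pose M : 'M[R]_n := \matrix_(i, j) A (enum_val j) (enum_val i).
have Mu : M \in unitmx.
  rewrite -row_free_unit -kermx_eq0; apply/eqP/row_matrixP => i; rewrite row0.
  set r := row i _.
  (* a row of the kernel of M, read on V, is annihilated by A *)
  have rM : r *m M = 0 by rewrite /r -row_mul mulmx_ker row0.
  have h0 : (fun y => r 0 (enum_rank y)) =1 (fun=> 0).
    apply: hinj => x; have /matrixP/(_ 0 (enum_rank x)) := rM.
    rewrite !mxE => <-; rewrite [RHS](reindex enum_rank) /=; last first.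
      exact: onW_bij (enum_rank_bij _).
    by apply: eq_bigr => y _; rewrite !mxE !enum_rankK mulrC.
  by apply/rowP => j; have := h0 (enum_val j); rewrite /= enum_valK => ->; rewrite mxE.
have key (P Q : 'M[R]_n) u x : P *m Q = 1%:M ->
    \sum_y Q (enum_rank y) (enum_rank x) *
      (\sum_z P (enum_rank z) (enum_rank y) * u z) = u x.
  move=> /matrixP PQ.
  under eq_bigr do rewrite mulr_sumr.
  rewrite exchange_big /= (bigD1 x) //= [X in _ + X]big1 ?addr0 => [|z zx].
    rewrite -[RHS]mul1r; have := PQ (enum_rank x) (enum_rank x).
    rewrite !mxE eqxx mulr1n => <-; rewrite mulr_suml (reindex enum_rank) /=; last first.
      exact: onW_bij (enum_rank_bij _).
    by apply: eq_bigr => y _; ring.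
  have := PQ (enum_rank z) (enum_rank x).
  rewrite !mxE (inj_eq enum_rank_inj) (negPf zx) => h.
  transitivity (0%:R * u z); last by rewrite mul0r.
  rewrite -h mulr_suml [RHS](reindex enum_rank) /=; last first.
    exact: onW_bij (enum_rank_bij _).
  by apply: eq_bigr => y _; ring.
have AE x y : A x y = M (enum_rank y) (enum_rank x) by rewrite mxE !enum_rankK.
exists (fun x y => invmx M (enum_rank y) (enum_rank x)); split=> u x.
  rewrite -[RHS](key _ _ u x (mulVmx Mu)).
  by apply: eq_bigr => y _; rewrite AE.
rewrite -[RHS](key _ _ u x (mulmxV Mu)).
by apply: eq_bigr => y _; congr (_ * _); apply: eq_bigr => z _; rewrite AE.
Qed.

(** The squared norm of [B u] as the quadratic form of the Gram kernel of [B],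
    so that [ip_kapp_le] also bounds operators. *)
Lemma ip_kapp2 B u :
  ip (kapp B u) (kapp B u) = ip (kapp (fun y z => \sum_x B x y * B x z) u) u.
Proof.
rewrite kapp_adj ipC; apply: eq_ip => // y; rewrite /kapp.
under eq_bigr do rewrite mulr_sumr.
rewrite exchange_big; apply: eq_bigr => z _ /=; rewrite mulr_suml.
by apply: eq_bigr => x _; ring.
Qed.

(** Nonnegativity of the form at u - t A u with t = 1 / C, where C bounds
    the form of A, gives <A u, u> >= |A u|^2 / C; the inverse of A then bounds
    |u| by |A u|. *)
Lemma psd_inj_coercive A : (forall x y, A x y = A y x) ->
    (forall u, 0 <= ip (kapp A u) u) ->
    (forall u, kapp A u =1 (fun=> 0) -> u =1 (fun=> 0)) ->
  exists2 c : R, 0 < c & forall u, c * ip u u <= ip (kapp A u) u.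
Proof.
move=> hA hpos /kernel_inverse [B [_ BA]].
pose C := kabs A + 1; pose K := kabs (fun y z => \sum_x B x y * B x z) + 1.
have C0 : 0 < C by rewrite ltr_wpDl ?kabs_ge0.
have K0 : 0 < K by rewrite ltr_wpDl ?kabs_ge0.
exists (C * K)^-1 => [|u]; first by rewrite invr_gt0 mulr_gt0.
have h1 : ip u u <= K * ip (kapp A u) (kapp A u).
  rewrite -(eq_ip (BA u) (BA u)) ip_kapp2.
  apply: le_trans (ip_kapp_le _ _) _.
  by rewrite ler_wpM2r ?ip_ge0 // lerDl.
have h2 : ip (kapp A (kapp A u)) (kapp A u) <= C * ip (kapp A u) (kapp A u).
  apply: le_trans (ip_kapp_le _ _) _.
  by rewrite ler_wpM2r ?ip_ge0 // lerDl.
have h3 := hpos (fun x => 1 * u x + (- C^-1) * kapp A u x).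
have h4 : ip (kapp A (fun x => 1 * u x + - C^-1 * kapp A u x))
     (fun x => 1 * u x + - C^-1 * kapp A u x)
  = ip (kapp A u) u - 2 * C^-1 * ip (kapp A u) (kapp A u)
    + C^-1 ^+ 2 * ip (kapp A (kapp A u)) (kapp A u).
  rewrite (eq_ip (kapp_lin A _ _ _ _) (frefl _)) ip_linl ![ip (kapp A _) (fun x => _)]ipC.
  rewrite !ip_linl ![ip u _]ipC (kapp_sym (kapp A u) u hA).
  by rewrite [ip (kapp A u) (kapp A (kapp A u))]ipC; ring.
rewrite h4 in h3.
have h5 : C^-1 ^+ 2 * ip (kapp A (kapp A u)) (kapp A u) <=
   C^-1 * ip (kapp A u) (kapp A u).
  apply: le_trans (ler_wpM2l (sqr_ge0 _) h2) _.
  by rewrite expr2 mulrA mulfVK ?gt_eqF.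
have h6 : C^-1 * ip (kapp A u) (kapp A u) <= ip (kapp A u) u by lra.
rewrite invfM -mulrA; apply: le_trans h6; rewrite ler_pM2l ?invr_gt0 //.
by rewrite ler_pdivrMl.
Qed.

(** Let s be the supremum of the Rayleigh quotient of A.  The form s - A is
    nonnegative; if it were injective it would be coercive, and a number
    smaller than s would still bound the quotient.  So s is an
    eigenvalue. *)
Lemma rayleigh_le A (mu : R) : (forall x y, A x y = A y x) ->
    (forall nu u, (exists x, u x != 0) ->
       kapp A u =1 (fun x => nu * u x) -> nu <= mu) ->
  forall u, ip (kapp A u) u <= mu * ip u u.
Proof.
move=> hA hmu u.
have [/ip_eq0 u0|u0] := eqVneq (ip u u) 0.
  have z v : ip v u = 0 by apply: big1 => x _; rewrite u0 mulr0.
  by rewrite !z mulr0.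
pose E : classical_sets.set R := fun r => exists2 v, ip v v = 1 & r = ip (kapp A v) v.
have scale v : ip v v != 0 -> exists2 r, E r & ip (kapp A v) v = r * ip v v.
  move=> v0; have vp : 0 < ip v v by rewrite lt_def v0 ip_ge0.
  pose a := (Num.sqrt (ip v v))^-1.
  have aa : a * a = (ip v v)^-1.
    by rewrite -expr2 exprVn sqr_sqrtr // ltW.
  pose w := fun x => a * v x + 0 * v x.
  have hw z : ip w z = a * ip v z by rewrite ip_linl mul0r addr0.
  have hAw z : ip (kapp A w) z = a * ip (kapp A v) z.
    by rewrite (eq_ip (kapp_lin A _ _ _ _) (frefl _)) ip_linl mul0r addr0.
  exists (ip (kapp A w) w); last first.
    by rewrite hAw [ip _ w]ipC hw [ip v (kapp A v)]ipC mulrA aa mulrAC mulVf ?mul1r.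
  by exists w => //=; rewrite hw ipC hw mulrA aa mulVf.
have ubE : classical_sets.ubound E (kabs A).
  move=> r [v hv ->]; apply: le_trans (ip_kapp_le _ _) _.
  by rewrite hv mulr1.
have [r0 Er0 _] := scale _ u0.
have supE : classical_sets.has_sup E by split; [exists r0 | exists (kabs A)].
pose s := sup E.
have hs v : ip (kapp A v) v <= s * ip v v.
  have [/ip_eq0 v0|v0] := eqVneq (ip v v) 0.
    have z w : ip w v = 0 by apply: big1 => x _; rewrite v0 mulr0.
    by rewrite !z mulr0.
  have [r Er ->] := scale _ v0.
  by rewrite ler_wpM2r ?ip_ge0 // sup_upper_bound.
apply: le_trans (hs u) _; rewrite ler_wpM2r ?ip_ge0 //.
pose A' x y := s * (x == y)%:R - A x y.
have A'E v x : kapp A' v x = s * v x + (-1) * kapp A v x.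
  rewrite /kapp /A'; under eq_bigr do rewrite mulrBl.
  rewrite sumrB mulN1r; congr (_ - _).
  rewrite (bigD1 x) //= eqxx mulr1 big1 ?addr0 // => y yx.
  by rewrite eq_sym (negPf yx) mulr0 mul0r.
rewrite leNgt; apply/negP => mus.
have [c c0 hc] : exists2 c : R, 0 < c & forall u, c * ip u u <= ip (kapp A' u) u.
  apply: psd_inj_coercive.
  - by move=> x y; rewrite /A' eq_sym hA.
  - move=> v; rewrite (eq_ip (A'E v) (frefl _)) ip_linl.
    by have := hs v; lra.
  move=> v v0 x; apply/eqP; rewrite -[_ == _]negbK; apply/negP => vx.
  have : s <= mu; last by rewrite leNgt mus.
  apply: (hmu s v); first by exists x.
  by move=> y; have := v0 y; rewrite A'E; lra.
have : s <= s - c; last by lra.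
apply: ge_sup => [|r [v hv ->]]; first by exists r0.
have := hc v; rewrite (eq_ip (A'E v) (frefl _)) ip_linl hv; lra.
Qed.

End Kernels.

(** * The carre du champ of a signed graph *)

Section GammaCalculus.
Variables (R : realType) (V : finType) (e : rel V) (D : nat).
Variable sigma : V -> V -> R.
Hypotheses (hsym : symmetric e) (hsig : is_signature e sigma).
Implicit Types f g h u : V -> R.

Local Notation Lap := (laplacian e D).
Local Notation LapS := (sig_laplacian e D sigma).
Local Notation Gam := (Gamma e D sigma).
Local Notation grad g x y := (sigma x y * g y - g x).

Lemma sig_sqr x y : e x y -> sigma x y * sigma x y = 1.
Proof. by move=> /hsig [[] -> _]; rewrite ?mulr1 // mulrNN mulr1. Qed.

Lemma sig_sym x y : e x y -> sigma y x = sigma x y.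
Proof. by move=> /hsig [[] -> ->]; rewrite ?invr1 // invrN1. Qed.

(** Since sigma ^ 2 = 1 on edges, the definition by polarization of the
    Laplacian is a sum of products of signed differences. *)
Lemma GammaE f g x :
  Gam f g x = (2 * D%:R)^-1 * \sum_(y | e x y) grad f x y * grad g x y.
Proof.
have -> : \sum_(y | e x y) grad f x y * grad g x y
    = \sum_(y | e x y) (f y * g y - f x * g x)
      - f x * \sum_(y | e x y) grad g x y - (\sum_(y | e x y) grad f x y) * g x.
  rewrite mulr_sumr mulr_suml -!sumrB; apply: eq_bigr => y /sig_sqr h.
  rewrite -[f y * g y]mul1r -h; ring.
rewrite /Gamma /laplacian /sig_laplacian invfM; ring.
Qed.

Lemma Gamma_ge0 f x : 0 <= Gam f f x.
Proof.
rewrite GammaE mulr_ge0 ?invr_ge0 ?mulr_ge0 //.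
by apply: sumr_ge0 => y _; rewrite -expr2 sqr_ge0.
Qed.

Lemma Gamma_step f g (s : R) x :
  Gam (fun z => f z - s * g z) (fun z => f z - s * g z) x
  = Gam f f x - s * (Gam f g x + Gam g f x) + s ^+ 2 * Gam g g x.
Proof.
rewrite !GammaE -!mulrDr mulrCA -[s ^+ 2 * _]mulrCA -mulrBr -mulrDr.
congr (_ * _); rewrite -big_split /= !mulr_sumr -sumrB -big_split /=.
by apply: eq_bigr => y _; ring.
Qed.

Lemma sum_laplacian u : \sum_x Lap u x = 0.
Proof.
rewrite /laplacian -mulr_sumr.
under eq_bigr do rewrite sumrB.
rewrite sumrB [X in X - _](exchange_big_dep predT) //= -sumrB big1 ?mulr0 // => x _.
by apply/eqP; rewrite subr_eq0; apply/eqP; apply: eq_bigl => y; rewrite hsym.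
Qed.

Lemma sig_laplacian_sym f g : ip (LapS f) g = ip f (LapS g).
Proof.
rewrite /ip /sig_laplacian.
under eq_bigr do rewrite -mulrA.
under [RHS]eq_bigr do rewrite mulrCA.
rewrite -!mulr_sumr; congr (_ * _).
under eq_bigr do rewrite sumrB mulrBl.
under [RHS]eq_bigr do rewrite sumrB mulrBr.
rewrite !sumrB; congr (_ - _); last first.
  by apply: eq_bigr => x _; rewrite mulr_suml mulr_sumr; apply: eq_bigr => y _; ring.
under eq_bigr do rewrite mulr_suml.
under [RHS]eq_bigr do rewrite mulr_sumr.
rewrite (exchange_big_dep predT) //=; apply: eq_bigr => x _.
apply: eq_big => [y|y exy]; first by rewrite hsym.
by rewrite (sig_sym exy); ring.
Qed.

(** Integration by parts. *)
Lemma sum_Gamma f g : \sum_x Gam f g x = - ip (LapS f) g.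
Proof.
rewrite /Gamma -mulr_sumr !sumrB sum_laplacian.
rewrite -[\sum_x f x * _]/(ip f (LapS g)) -[\sum_x _ * g x]/(ip (LapS f) g).
by rewrite -sig_laplacian_sym; field.
Qed.

(** At a maximum point of [u] the Laplacian is nonpositive. *)
Lemma maximum_principle (s c : R) u : 0 <= s ->
  (forall x, u x - s * Lap u x <= c) -> forall x, u x <= c.
Proof.
move=> s0 hu x.
have [m _ hm] := arg_maxP u (isT : xpredT x).
apply: le_trans (hm x isT) _; apply: le_trans (hu m).
rewrite lerDl oppr_ge0 mulr_ge0_le0 // /laplacian mulr_ge0_le0 ?invr_ge0 //.
by apply: sumr_le0 => y _; rewrite subr_le0; exact: hm.
Qed.

(** * Implicit Euler steps of the signed heat flow *)

(** Each [F k.+1] is the image of [F k] under the resolvent of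
    minus the signed Laplacian, written without the inverse. *)
Definition resolvent_iterates (s : R) (F : nat -> V -> R) :=
  forall k x, F k x = F k.+1 x - s * LapS (F k.+1) x.

(** 1 + s L is injective because L is nonnegative by [sum_Gamma]. *)
Lemma resolvent_iterates_exist (s : R) g : 0 <= s ->
  exists F, F 0%N = g /\ resolvent_iterates s F.
Proof.
move=> s0.
(* the kernel of 1 + s L; the sum of ones is the degree of x *)
pose K x y := (x == y)%:R - s * (D%:R^-1 *
   ((e x y)%:R * sigma x y - (\sum_(z | e x z) 1) * (x == y)%:R)).
have KE u x : kapp K u x = u x - s * LapS u x.
  rewrite /kapp /K /sig_laplacian.
  under eq_bigr do rewrite mulrBl.
  rewrite sumrB (bigD1 x) //= eqxx mul1r big1 ?addr0 => [|y yx]; last first.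
    by rewrite eq_sym (negPf yx) mul0r.
  set d := \sum_(z | e x z) 1; congr (_ - _).
  transitivity (s * (D%:R^-1 *
     \sum_y ((e x y)%:R * sigma x y * u y - d * (x == y)%:R * u y))).
    by rewrite !mulr_sumr; apply: eq_bigr => y _; ring.
  congr (_ * (_ * _)); rewrite !sumrB; congr (_ - _).
    rewrite [RHS]big_mkcond; apply: eq_bigr => y _.
    by case: ifP => _; rewrite ?mul1r ?mul0r.
  rewrite (bigD1 x) //= eqxx mulr1 big1 ?addr0 => [|y yx]; last first.
    by rewrite eq_sym (negPf yx) mulr0 mul0r.
  by rewrite mulr_suml; apply: eq_bigr => y _; rewrite mul1r.
have [B [KB _]] : exists B, (forall u, kapp K (kapp B u) =1 u)
         /\ (forall u, kapp B (kapp K u) =1 u).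
  apply: kernel_inverse => u hu; apply: ip_eq0; apply/eqP.
  rewrite eq_le ip_ge0 andbT.
  have : ip (fun x => 1 * u x + (- s) * LapS u x) u = 0.
    by apply: big1 => x _; have := hu x; rewrite KE => h; rewrite mul1r mulNr h mul0r.
  rewrite ip_linl mul1r mulNr -mulrN -sum_Gamma => h.
  have : 0 <= s * \sum_x Gam u u x.
    by rewrite mulr_ge0 // sumr_ge0 // => x _; exact: Gamma_ge0.
  by lra.
by exists (fun k => iter k (kapp B) g); split=> // k x; rewrite -KE KB.
Qed.

End GammaCalculus.

(** * The gradient estimate under nonnegative curvature *)

Section GradientEstimate.
Variables (R : realType) (V : finType) (e : rel V) (D : nat).
Variable sigma : V -> V -> R.
Hypotheses (hsig : is_signature e sigma) (hCD : CD_0_oo e D sigma).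
Implicit Types f g h u : V -> R.

Local Notation Lap := (laplacian e D).
Local Notation LapS := (sig_laplacian e D sigma).
Local Notation Gam := (Gamma e D sigma).

Variables (s : R) (f : nat -> V -> R).
Hypotheses (s_ge0 : 0 <= s) (hf : resolvent_iterates e D sigma s f).

(** Expanding the square of F k = F (k+1) + s L (F (k+1)) leaves the term
    s^2 (L F (k+1))^2, which is dropped. *)
Lemma resolvent_sqr k x :
  f k.+1 x ^+ 2 - s * Lap (fun z => f k.+1 z ^+ 2) x + 2 * s * Gam (f k.+1) (f k.+1) x
  <= f k x ^+ 2.
Proof.
rewrite (hf k x) /Gamma.
rewrite (_ : (fun z => f k.+1 z * f k.+1 z) = (fun z => f k.+1 z ^+ 2)) //.
set a := f k.+1 x; set b := LapS _ x; set c := Lap _ x.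
have := mulr_ge0 (sqr_ge0 s) (sqr_ge0 b); lra.
Qed.

(** The same expansion for Gamma; here the mixed term is controlled by
    Gamma2, hence by the curvature condition. *)
Lemma resolvent_Gamma k x :
  Gam (f k.+1) (f k.+1) x - s * Lap (Gam (f k.+1) (f k.+1)) x
  <= Gam (f k) (f k) x.
Proof.
have -> : Gam (f k) (f k) x =
   Gam (fun z => f k.+1 z - s * LapS (f k.+1) z)
       (fun z => f k.+1 z - s * LapS (f k.+1) z) x.
  by rewrite !GammaE //; congr (_ * _); apply: eq_bigr => y _; rewrite !(hf k).
rewrite Gamma_step //.
have := mulr_ge0 s_ge0 (hCD (f k.+1) x); rewrite /Gamma2.
have := mulr_ge0 (sqr_ge0 s) (Gamma_ge0 D hsig (LapS (f k.+1)) x).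
lra.
Qed.

Hypothesis f0_le1 : forall x, f 0 x ^+ 2 <= 1.

(** One application of 1 - s Delta maps the left-hand side at k + 1 below
    the left-hand side at k: the loss 2 s Gamma(F (k+1)) in [resolvent_sqr] pays for
    the increase of the coefficient of Gamma. *)
Lemma resolvent_energy_le1 k x :
  f k x ^+ 2 + 2 * s * k%:R * Gam (f k.+1) (f k.+1) x <= 1.
Proof.
elim: k x => [|k IHk] x; first by rewrite mulr0 mul0r addr0.
apply: (@maximum_principle _ _ e D s 1
  (fun x => f k.+1 x ^+ 2 + 2 * s * k.+1%:R * Gam (f k.+2) (f k.+2) x)) => // y.
apply: le_trans (IHk y).
have -> : Lap (fun x => f k.+1 x ^+ 2 + 2 * s * k.+1%:R * Gam (f k.+2) (f k.+2) x) y
  = Lap (fun z => f k.+1 z ^+ 2) y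
    + 2 * s * k.+1%:R * Lap (Gam (f k.+2) (f k.+2)) y.
  rewrite /laplacian [RHS]addrC [X in _ = X + _]mulrCA -mulrDr; congr (_ * _).
  by rewrite mulr_sumr -big_split; apply: eq_bigr => z _ /=; ring.
have c0 : 0 <= 2 * s * k.+1%:R by rewrite !mulr_ge0.
have := ler_wpM2l c0 (resolvent_Gamma k.+1 y).
have := resolvent_sqr k y; rewrite -natr1; lra.
Qed.

Lemma resolvent_Gamma_le k x : 0 < s ->
  Gam (f k.+2) (f k.+2) x <= (2 * s * k.+1%:R)^-1.
Proof.
move=> s0; have c0 : 0 < 2 * s * k.+1%:R by rewrite !mulr_gt0.
rewrite -[X in _ <= X]mulr1 ler_pdivlMl //.
by have := resolvent_energy_le1 k.+1 x; have := sqr_ge0 (f k.+1 x); lra.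
Qed.

Hypotheses (D_gt0 : (0 < D)%N) (hreg : regular_graph e D).

(** The first step is not covered by [resolvent_Gamma_le] and is bounded
    directly: on a regular graph Delta (F 1 ^ 2) is at most
    1 - F 1 ^ 2, which [resolvent_sqr] turns into a bound on Gamma. *)
Lemma resolvent_Gamma1_le x : 0 < s -> Gam (f 1) (f 1) x <= (1 + s) * (2 * s)^-1.
Proof.
move=> s0; rewrite ler_pdivlMr ?mulr_gt0 //.
have f1 y : f 1%N y ^+ 2 <= 1.
  have h := resolvent_energy_le1 1 y.
  have : 0 <= 2 * s * 1 * Gam (f 2) (f 2) y.
    by apply: mulr_ge0; [rewrite !mulr_ge0 | exact: Gamma_ge0].
  by lra.
have hL : Lap (fun z => f 1%N z ^+ 2) x <= 1 - f 1%N x ^+ 2.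
  rewrite /laplacian ler_pdivrMl ?ltr0n //.
  have -> : D%:R * (1 - f 1%N x ^+ 2) = \sum_(y | e x y) (1 - f 1%N x ^+ 2).
    rewrite sumr_const -[RHS]mulr_natl; congr (_%:R * _).
    by rewrite -(hreg x); apply: eq_card => y; rewrite inE.
  by apply: ler_sum => y _; rewrite lerD2r.
have := resolvent_sqr 0 x; have := f0_le1 x.
have := sqr_ge0 (f 1%N x).
have := ler_wpM2l s_ge0 hL.
have := mulr_ge0 s_ge0 (sqr_ge0 (f 1%N x)).
lra.
Qed.

End GradientEstimate.

(** * Spectral decay of the iterates *)

Section Decay.
Variables (R : realType) (V : finType) (e : rel V) (D : nat).
Variable sigma : V -> V -> R.
Variables (s lam : R) (f : nat -> V -> R).
Hypotheses (s_ge0 : 0 <= s) (lam_ge0 : 0 <= lam).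
Hypothesis hf : resolvent_iterates e D sigma s f.
Hypothesis hlam : forall u, lam * ip u u <= - ip (sig_laplacian e D sigma u) u.

Local Notation rho := (1 + s * lam).

Let rho_gt0 : 0 < rho.
Proof. by rewrite ltr_wpDr // mulr_ge0. Qed.

Lemma resolvent_ip k g :
  ip (f k) g = ip (f k.+1) g - s * ip (sig_laplacian e D sigma (f k.+1)) g.
Proof.
have h x : f k x = 1 * f k.+1 x + (- s) * sig_laplacian e D sigma (f k.+1) x.
  by rewrite (hf k) mul1r mulNr.
by rewrite (eq_ip h (frefl g)) ip_linl mul1r mulNr.
Qed.

(** Pairing F k = (1 + s L) F (k+1) with F (k+1) gives
    rho |F (k+1)|^2 <= <F k, F (k+1)>, and the weighted Young inequality then
    gives the contraction factor 1 / rho. *)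
Lemma resolvent_norm_decay k : ip (f k) (f k) <= (rho^-1 ^+ k) ^+ 2 * ip (f 0) (f 0).
Proof.
elim: k => [|k IHk]; first by rewrite !expr1n mul1r.
have h1 : rho * ip (f k.+1) (f k.+1) <= ip (f k) (f k.+1).
  rewrite (resolvent_ip k); have := ler_wpM2l s_ge0 (hlam (f k.+1)); lra.
have ri : 0 < rho^-1 by rewrite invr_gt0.
have h2 := ip_young (f k) (f k.+1) ri; rewrite invrK in h2.
have h3 : rho * ip (f k.+1) (f k.+1) <= rho^-1 * ip (f k) (f k) by lra.
rewrite -(ler_pM2l rho_gt0); apply: le_trans h3 _.
apply: le_trans (ler_wpM2l (ltW ri) IHk) _.
rewrite le_eqVlt; apply/orP; left; apply/eqP.
by rewrite [_ ^+ k.+1]exprS; set q := _ ^+ k; field; rewrite gt_eqF.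
Qed.

Lemma resolvent_ip_decay k : ip (f k) (f 0) <= rho^-1 ^+ k * ip (f 0) (f 0).
Proof.
set q := rho^-1 ^+ k; have q0 : 0 < q by rewrite exprn_gt0 ?invr_gt0.
have qi : 0 < q^-1 by rewrite invr_gt0.
have h := ip_young (f k) (f 0) qi; rewrite invrK in h.
have := ler_wpM2l (ltW qi) (resolvent_norm_decay k).
rewrite -/q expr2 !mulrA mulVf ?gt_eqF // mul1r; lra.
Qed.

Lemma resolvent_telescope m :
  ip (f 0) (f 0) - ip (f m) (f 0)
  = s * \sum_(k < m) - ip (sig_laplacian e D sigma (f k.+1)) (f 0).
Proof.
elim: m => [|m IHm]; first by rewrite big_ord0 mulr0 subrr.
rewrite big_ord_recr mulrDr /= -IHm (resolvent_ip m); ring.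
Qed.

End Decay.

(** * From the decay estimate to a quadratic bound *)

Section Numerics.
Variable R : realType.

Lemma bernoulli (x : R) n : 0 <= x -> 1 + n%:R * x <= (1 + x) ^+ n.
Proof.
move=> x0; elim: n => [|n IHn]; first by rewrite mul0r addr0.
rewrite exprS -natr1; have x1 : 0 <= 1 + x by lra.
apply: le_trans (ler_wpM2l x1 IHn).
have := mulr_ge0 (ler0n R n) (mulr_ge0 x0 x0); lra.
Qed.

(** From (14/15)^10 >= 1/2 and ln (14/15) <= - 1/15. *)
Lemma ln2_ge : 2 / 3 <= ln 2 :> R.
Proof.
have h : ln (14 / 15 : R) <= - (1 / 15).
  have -> : 14 / 15 = 1 + - (1 / 15) :> R by field.
  by apply: le_ln1Dx; lra.
have : ln (2^-1 : R) <= ln ((14 / 15) ^+ 10).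
  by rewrite ler_ln ?posrE //; lra.
rewrite lnV ?posrE // lnXn //; lra.
Qed.

(** With s m = 5 / (4 lam) and m large the hypothesis tends to
    1 - exp (- 5/4) <= sqrt 5 sqrt (d / lam) p, that is lam <= 9.83 d p^2.
    The margin up to 32/3 allows a finite m. *)
Lemma quadratic_of_decay (lam d p : R) : 0 < lam -> 0 <= d ->
    (forall (s : R) m, 0 < s -> s <= 1 ->
       1 - (1 + s * lam)^-1 ^+ m
       <= (3 / 2 + 2 * Num.sqrt m%:R) * Num.sqrt (s * d) * p) ->
  lam <= 32 / 3 * (d * p ^+ 2).
Proof.
move=> lam0 d0 hdecay.
(* m = 20 N steps of size s = 1 / (16 N lam); N >= 500 makes 3/2
   negligible against sqrt m, and N >= 1 / lam makes s <= 1 *)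
pose N := (500 + Num.Def.archi_bound lam^-1)%N.
have Nlam : 1 <= N%:R * lam.
  rewrite -ler_pdivrMr // mul1r /N natrD.
  have := archi_boundP (ltW (_ : 0 < lam^-1)); rewrite invr_gt0 => /(_ lam0).
  set b := _%:R; lra.
have N500 : 500 <= N%:R :> R by rewrite ler_nat leq_addr.
have N0 : 0 < N%:R :> R by lra.
pose s := (16 * N%:R * lam)^-1.
have s0 : 0 < s by rewrite invr_gt0 !mulr_gt0.
have s1 : s <= 1 by rewrite invf_le1 ?mulr_gt0 //; lra.
have h := hdecay s (20 * N)%N s0 s1.
have slam : s * lam = (16 * N%:R)^-1 by rewrite /s; field; rewrite !gt_eqF.
have pow : (1 + s * lam)^-1 ^+ (20 * N) <= 10 / 33.
  rewrite exprVn mulnC exprM slam.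
  have x0 : 0 <= (16 * N%:R)^-1 :> R by rewrite invr_ge0 mulr_ge0.
  (* so that (1 + s lam)^m >= (17/16)^20 >= 3.3 whatever N is *)
  have bern : 17 / 16 <= (1 + (16 * N%:R)^-1) ^+ N :> R.
    have := bernoulli N x0.
    have -> : N%:R * (16 * N%:R)^-1 = 1 / 16 :> R by field; rewrite gt_eqF.
    lra.
  have : (17 / 16) ^+ 20 <= ((1 + (16 * N%:R)^-1) ^+ N) ^+ 20 :> R.
    by rewrite lerXn2r ?nnegrE ?exprn_ge0 //; lra.
  set b := (_ ^+ N) ^+ 20 => hb; have hb' : 33 / 10 <= b by apply: le_trans hb; lra.
  have b0 : 0 < b by lra.
  by rewrite -[b^-1]mul1r ler_pdivrMr //; lra.
set w := Num.sqrt (20 * N)%:R in h; set z := Num.sqrt (s * d) in h.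
have w2 : w ^+ 2 = 20 * N%:R by rewrite sqr_sqrtr // natrM.
have z2 : z ^+ 2 = s * d by rewrite sqr_sqrtr // mulr_ge0 // ltW.
have w100 : 100 <= w.
  rewrite -ler_sqr ?nnegrE ?sqrtr_ge0 // w2; lra.
have w0 : 0 < w by lra.
have z0 : 0 <= z by rewrite sqrtr_ge0.
set q := _ ^+ _ in pow h.
have p0 : 0 < p.
  rewrite ltNge; apply/negP => pn.
  have a0 : 0 <= (3 / 2 + 2 * w) * z by rewrite mulr_ge0 //; lra.
  by have := mulr_ge0_le0 a0 pn; lra.
have zp0 : 0 <= z * p by rewrite mulr_ge0 // ltW.
have h1 : 23 / 33 <= 403 / 200 * w * z * p.
  have w1 : 3 / 2 + 2 * w <= 403 / 200 * w by lra.
  by have := ler_wpM2r zp0 w1; rewrite !mulrA; lra.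
have h2 : (23 / 33) ^+ 2 <= (403 / 200) ^+ 2 * (20 * N%:R) * (s * d) * p ^+ 2.
  rewrite -w2 -z2 -!exprMn; apply: lerXn2r => //; rewrite nnegrE; lra.
have h3 : lam * (23 / 33) ^+ 2 <= (403 / 200) ^+ 2 * (5 / 4) * (d * p ^+ 2).
  apply: le_trans (ler_wpM2l (ltW lam0) h2) _.
  rewrite le_eqVlt; apply/orP; left; apply/eqP.
  by rewrite /s; field; rewrite !gt_eqF.
have dp : 0 <= d * p ^+ 2 by rewrite mulr_ge0 ?sqr_ge0.
lra.
Qed.

End Numerics.

(** * The Buser inequality for signed graphs *)

Section Buser.
Variables (R : realType) (V : finType) (e : rel V) (D : nat).
Variable sigma : V -> V -> R.
Hypotheses (D_gt0 : (0 < D)%N) (hsym : symmetric e) (hreg : regular_graph e D).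
Hypotheses (hsig : is_signature e sigma) (hCD : CD_0_oo e D sigma).

Local Notation LapS := (sig_laplacian e D sigma).
Local Notation Gam := (Gamma e D sigma).
Local Notation grad g x y := (sigma x y * g y - g x).

Definition variation (g : V -> R) : R := \sum_x \sum_(y | e x y) `|grad g x y|.

Lemma Gamma_le_grad (g h : V -> R) (b : R) x : 0 <= b -> Gam g g x <= b ^+ 2 ->
  Gam g h x <= b / Num.sqrt (2 * D%:R) * \sum_(y | e x y) `|grad h x y|.
Proof.
move=> b0 hb; set w := Num.sqrt _.
have D2 : 0 < 2 * D%:R :> R by rewrite mulr_gt0 ?ltr0n.
have w0 : 0 < w by rewrite sqrtr_gt0.
have w2 : w ^+ 2 = 2 * D%:R by rewrite sqr_sqrtr // ltW.
have hg y : e x y -> `|grad g x y| <= b * w.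
  move=> exy; rewrite -ler_sqr ?nnegrE ?mulr_ge0 // ?(ltW w0) //.
  rewrite exprMn w2 [b ^+ 2 * _]mulrC -ler_pdivrMl // real_normK ?num_real //.
  apply: le_trans hb; rewrite GammaE // ler_pM2l ?invr_gt0 //.
  rewrite (bigD1 y) //= expr2 lerDl.
  by apply: sumr_ge0 => z _; rewrite -expr2 sqr_ge0.
have -> : b / w = w ^- 2 * (b * w).
  by field; rewrite gt_eqF.
rewrite GammaE // -w2 -mulrA ler_pM2l ?invr_gt0 ?exprn_gt0 // mulr_sumr.
apply: ler_sum => y exy; apply: le_trans (ler_norm _) _.
by rewrite normrM ler_wpM2r // hg.
Qed.

(** Up to the factor 1 / sqrt (2 s), the bound on the gradient of F (k+1)
    for s <= 1; 3/2 at k = 0 bounds sqrt (1 + s). *)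
Let step (k : nat) : R := if k is 0 then 3 / 2 else (Num.sqrt k%:R)^-1.

(** Comparison with the integral: 1 / sqrt (m+1) is at most
    2 (sqrt (m+1) - sqrt m). *)
Lemma sum_step m : \sum_(k < m) step k <= 3 / 2 + 2 * Num.sqrt m%:R.
Proof.
case: m => [|m].
  by rewrite big_ord0; have := sqrtr_ge0 (0%:R : R); lra.
suff h : \sum_(k < m.+1) step k <= 3 / 2 + 2 * Num.sqrt m%:R.
  apply: le_trans h _; rewrite lerD2l ler_pM2l // ler_sqrt // ler_nat //.
elim: m => [|m IHm]; first by rewrite big_ord1 /= sqrtr0 mulr0 addr0.
rewrite big_ord_recr /=.
set a := Num.sqrt m.+1%:R; set c := Num.sqrt m%:R in IHm *.
have a0 : 0 < a by rewrite sqrtr_gt0.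
have c0 : 0 <= c by rewrite sqrtr_ge0.
have ac : a ^+ 2 = c ^+ 2 + 1 by rewrite !sqr_sqrtr // natr1.
have : a^-1 <= 2 * a - 2 * c; last by lra.
by rewrite -[X in X <= _]mulr1 ler_pdivrMl //; nra.
Qed.

(** The sum <g - F m, g> of the s <L F (k+1), g> is small by the gradient estimate and
    large by the spectral decay. *)
Lemma spectral_variation (s lam : R) (g : V -> R) m :
    0 < s -> s <= 1 -> 0 <= lam ->
    (forall u, lam * ip u u <= - ip (LapS u) u) ->
    (forall x, g x ^+ 2 <= 1) ->
  (1 - (1 + s * lam)^-1 ^+ m) * ip g g
  <= (3 / 2 + 2 * Num.sqrt m%:R) * Num.sqrt (s * D%:R) * (variation g / (2 * D%:R)).
Proof.
move=> s0 s1 lam0 hlam g1.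
have [f [f0 hf]] := resolvent_iterates_exist D hsym hsig g (ltW s0).
have D2 : 0 < 2 * D%:R :> R by rewrite mulr_gt0 ?ltr0n.
have s2 : 0 < 2 * s by rewrite mulr_gt0.
pose v := Num.sqrt (2 * s); pose w := Num.sqrt (2 * D%:R) : R.
have v0 : 0 < v by rewrite sqrtr_gt0.
have w0 : 0 < w by rewrite sqrtr_gt0.
have v2 : v ^+ 2 = 2 * s by rewrite sqr_sqrtr // ltW.
have w2 : w ^+ 2 = 2 * D%:R by rewrite sqr_sqrtr // ltW.
have step0 k : 0 <= step k by case: k => [|k] /=; [lra | rewrite invr_ge0 sqrtr_ge0].
have f01 x : f 0 x ^+ 2 <= 1 by rewrite f0.
have hG k x : Gam (f k.+1) (f k.+1) x <= (step k / v) ^+ 2.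
  rewrite expr_div_n v2; case: k => [|k] /=.
    apply: le_trans (resolvent_Gamma1_le hsig hCD (ltW s0) hf f01 D_gt0 hreg x s0) _.
    by rewrite ler_pM2r ?invr_gt0 //; lra.
  apply: le_trans (resolvent_Gamma_le hsig hCD (ltW s0) hf f01 k x s0) _.
  by rewrite exprVn sqr_sqrtr // invfM mulrC.
have hstep k : - ip (LapS (f k.+1)) g <= step k * (variation g / (v * w)).
  rewrite -(sum_Gamma D hsym hsig) /variation mulr_suml mulr_sumr.
  apply: ler_sum => x _.
  have sv0 : 0 <= step k / v by rewrite divr_ge0 // ltW.
  apply: le_trans (Gamma_le_grad g sv0 (hG k x)) _.
  by rewrite -/w invfM le_eqVlt; apply/orP; left; apply/eqP; ring.
have var0 : 0 <= variation g by apply: sumr_ge0 => x _; apply: sumr_ge0.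
have tel := resolvent_telescope hf m; rewrite f0 in tel.
have dec := resolvent_ip_decay (ltW s0) lam0 hf hlam m; rewrite f0 in dec.
have h1 : (1 - (1 + s * lam)^-1 ^+ m) * ip g g
   <= s * \sum_(k < m) step k * (variation g / (v * w)).
  rewrite mulrBl mul1r.
  have : s * (\sum_(k < m) - ip (LapS (f k.+1)) g)
     <= s * \sum_(k < m) step k * (variation g / (v * w)).
    by rewrite ler_pM2l //; apply: ler_sum => k _; exact: hstep.
  by move: tel dec; set q := _ ^+ m; lra.
apply: le_trans h1 _; rewrite -mulr_suml.
have -> : Num.sqrt (s * D%:R) = v * w / 2.
  have vw0 : 0 <= v * w / 2 by rewrite divr_ge0 ?mulr_ge0 ?(ltW v0) ?(ltW w0).
  rewrite -[RHS](ger0_norm vw0) -sqrtr_sqr.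
  by congr (Num.sqrt _); rewrite !exprMn v2 w2; field.
have -> : s * ((\sum_(k < m) step k) * (variation g / (v * w)))
   = (\sum_(k < m) step k) * (v * w / 2 * (variation g / (2 * D%:R))).
  have -> : s = v ^+ 2 / 2 by rewrite v2; field.
  by rewrite -w2; field; rewrite !gt_eqF.
rewrite -!mulrA ler_wpM2r ?sum_step //.
by rewrite !mulr_ge0 ?(ltW v0) ?(ltW w0) ?invr_ge0 // mulr_ge0.
Qed.

Lemma boundary_sizeE (S : {set V}) :
  (boundary_size e S)%:R = \sum_(x in S) \sum_(y | e x y && (y \notin S)) 1 :> R.
Proof.
rewrite /boundary_size cardsE -sum1_card natr_sum pair_big_dep /=.
by apply: eq_bigl => -[x y]; rewrite unfold_in /= [e x y && _]andbC.
Qed.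

Definition signed_indicator (S : {set V}) (tau : {ffun V -> bool}) (x : V) : R :=
  if x \in S then (-1) ^+ tau x else 0.

(** Edges inside S contribute to the frustration, edges leaving S contribute
    1, and each edge is seen from both ends. *)
Lemma variation_indicator (S : {set V}) tau :
  variation (signed_indicator S tau)
  = 2 * (frustration e sigma S tau + (boundary_size e S)%:R).
Proof.
have norm1 (b : bool) : `|(-1) ^+ b| = 1 :> R by rewrite normrX normrN1 expr1n.
have nsig x y : e x y -> `|sigma x y| = 1.
  by move=> /hsig [[] -> _]; rewrite ?normrN1 ?normr1.
rewrite /variation (bigID (mem S)) /=.
have -> : \sum_(x in S) \sum_(y | e x y)
      `|grad (signed_indicator S tau) x y|
    = 2 * frustration e sigma S tau + (boundary_size e S)%:R.
  rewrite /frustration mulrA divff ?pnatr_eq0 // mul1r boundary_sizeE -big_split.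
  apply: eq_bigr => x xS /=; rewrite (bigID (mem S)) /=; congr (_ + _).
    apply: eq_big => [y|y /andP[_ yS]]; first by rewrite andbC.
    by rewrite /signed_indicator xS yS.
  apply: eq_bigr => y /andP[exy yS].
  by rewrite /signed_indicator xS (negPf yS) mulr0 sub0r normrN norm1.
have -> : \sum_(x | x \notin S) \sum_(y | e x y)
      `|grad (signed_indicator S tau) x y| = (boundary_size e S)%:R.
  rewrite boundary_sizeE [RHS](exchange_big_dep [pred y | y \notin S]) /=; last first.
    by move=> x y _ /andP[].
  apply: eq_bigr => x xS; rewrite (bigID (mem S)) /= addrC big1 ?add0r.
    apply: eq_big => [y|y /andP[exy yS]]; first by rewrite xS andbT hsym andbC.
    by rewrite /signed_indicator yS (negPf xS) subr0 normrM nsig // norm1 mul1r.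
  move=> y /andP[exy yS].
  by rewrite /signed_indicator (negPf yS) (negPf xS) mulr0 subr0 normr0.
by ring.
Qed.

(** [spectral_variation] for the signed indicator, whose squared norm is
    #|S|. *)
Lemma buser_set (lam : R) (S : {set V}) tau : S != set0 ->
    (forall u, lam * ip u u <= - ip (LapS u) u) ->
  lam <= 16 * ln 2 * D%:R *
   ((frustration e sigma S tau + (boundary_size e S)%:R) / (D%:R * #|S|%:R)) ^+ 2.
Proof.
move=> S0 hlam; set p := _ / _.
have D0 : 0 < D%:R :> R by rewrite ltr0n.
have l2 := @ln2_ge R.
have p2 := sqr_ge0 p.
have [lam0|lam0] := leP lam 0.
  have l0 : 0 <= ln 2 :> R by lra.
  apply: le_trans lam0 _; apply: mulr_ge0 => //.
  by rewrite mulr_ge0 ?(ltW D0) // mulr_ge0.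
pose g := signed_indicator S tau.
have gg x : g x * g x = (x \in S)%:R.
  rewrite /g /signed_indicator; case: ifP => _; rewrite ?mulr0 //.
  by rewrite -expr2 sqrr_sign.
have g1 x : g x ^+ 2 <= 1 by rewrite expr2 gg; case: (x \in S).
have ngg : ip g g = #|S|%:R.
  rewrite /ip (eq_bigr _ (fun x _ => gg x)) -natr_sum; congr _%:R.
  by rewrite -sum1_card [RHS]big_mkcond; apply: eq_bigr => x _; case: (x \in S).
have cS : 0 < #|S|%:R :> R by rewrite ltr0n card_gt0.
have hvar : variation g / (2 * D%:R) = #|S|%:R * p.
  by rewrite variation_indicator /p; field; rewrite !gt_eqF.
have := @quadratic_of_decay R lam D%:R p lam0 (ltW D0).
have dp : 0 <= D%:R * p ^+ 2 by rewrite mulr_ge0 ?sqr_ge0 // ltW.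
have := ler_wpM2r dp l2 => h1 h2.
have : lam <= 32 / 3 * (D%:R * p ^+ 2); last by lra.
apply: h2 => t m t0 t1; rewrite -(ler_pM2r cS) -[X in _ * X <= _]ngg.
apply: le_trans (spectral_variation m t0 t1 (ltW lam0) hlam g1) _.
by rewrite hvar le_eqVlt; apply/orP; left; apply/eqP; ring.
Qed.

(** Both minima in the Cheeger constant are attained, so the bound for each
    set and each switching function passes to it. *)
Theorem buser_signed (lam : R) : (0 < #|V|)%N ->
    (forall u, lam * ip u u <= - ip (LapS u) u) ->
  lam <= 16 * ln 2 * D%:R * cheeger1 e D sigma ^+ 2.
Proof.
move=> V0 hlam.
have hphi (S : {set V}) : S != set0 -> lam <= 16 * ln 2 * D%:R * phi e D sigma S ^+ 2.
  move=> S0; rewrite /phi /frustration_index.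
  apply: (big_ind (fun r : R => lam <= 16 * ln 2 * D%:R *
     ((r + (boundary_size e S)%:R) / (D%:R * #|S|%:R)) ^+ 2)).
  - exact: buser_set.
  - by move=> a b ha hb; rewrite /Num.min; case: ifP.
  - by move=> tau _; exact: buser_set.
apply: (big_ind (fun r : R => lam <= 16 * ln 2 * D%:R * r ^+ 2)) => //.
- by apply: hphi; rewrite -card_gt0 cardsT.
- by move=> a b ha hb; rewrite /Num.min; case: ifP.
Qed.

End Buser.

(** * The largest eigenvalue of the Laplacian *)

Lemma laplacian_rayleigh (R : realType) (V : finType) (e : rel V) (D : nat) (mu : R) :
    symmetric e -> is_largest_eigenvalue e D mu ->
  forall u : V -> R, - ip (laplacian e D u) u <= mu * ip u u.
Proof.
move=> hsym [_ hmu] u.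
pose A x y : R := D%:R^-1 * ((\sum_(z | e x z) 1) * (x == y)%:R - (e x y)%:R).
have AE v x : kapp A v x = - laplacian e D v x.
  rewrite /kapp /laplacian /A -mulrN -sumrN; set d := \sum_(z | e x z) 1.
  transitivity (D%:R^-1 * \sum_y (d * (x == y)%:R * v y - (e x y)%:R * v y)).
    by rewrite mulr_sumr; apply: eq_bigr => y _; ring.
  congr (_ * _); rewrite sumrB (bigD1 x) //= eqxx mulr1 big1 ?addr0 => [|y yx].
    rewrite [X in _ - X](_ : _ = \sum_(y | e x y) v y); last first.
      rewrite [RHS]big_mkcond; apply: eq_bigr => y _.
      by case: ifP => _; rewrite ?mul1r ?mul0r.
    by rewrite mulr_suml -sumrB; apply: eq_bigr => y _; ring.
  by rewrite eq_sym (negPf yx) mulr0 mul0r.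
have -> : - ip (laplacian e D u) u = ip (kapp A u) u.
  by rewrite /ip -sumrN; apply: eq_bigr => x _; rewrite AE mulNr.
apply: rayleigh_le.
  move=> x y; rewrite /A hsym eq_sym; case: eqVneq => [->//|_].
  by rewrite !mulr0.
by move=> nu v v0 hv; apply: hmu; exists v; split=> // x; rewrite -AE hv.
Qed.

Theorem corollary1p2 (R : realType) (V : finType) (e : rel V) (D : nat)
    (hD : (1 <= D)%N)
    (hG : simple_graph e)
    (hreg : regular_graph e D)
    (hCD : CD_0_oo e D (@neg_triv_sig R V))
    (lambdaN : R)
    (hlambda : is_largest_eigenvalue e D lambdaN) :
  2 - lambdaN <= 16 * ln 2 * D%:R * cheeger1 e D (@neg_triv_sig R V) ^+ 2.
Proof.
have [hsym _] := hG.
apply: buser_signed => //.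
- exact: neg_triv_sigP.
- by have [[f [[x _] _]] _] := hlambda; apply/card_gt0P; exists x.
move=> u.
(* for the constant signature -1, L = 2 + Delta *)
have -> : - ip (sig_laplacian e D (@neg_triv_sig R V) u) u
   = 2 * ip u u + ip (laplacian e D u) u.
  have h x : sig_laplacian e D (@neg_triv_sig R V) u x
      = (- 2) * u x + (-1) * laplacian e D u x.
    have -> : u x = D%:R^-1 * \sum_(y | e x y) u x.
      rewrite sumr_const -[u x *+ _]mulr_natl mulrA.
      rewrite (_ : #|_| = D) ?mulVf ?mul1r ?pnatr_eq0 -?lt0n //.
      by rewrite -(hreg x); apply: eq_card => y; rewrite inE.
    rewrite /sig_laplacian /laplacian /neg_triv_sig mulrCA [X in _ + X]mulrCA -mulrDr.
    congr (_ * _); rewrite !mulr_sumr -big_split; apply: eq_bigr => y _ /=.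
    by ring.
  by rewrite (eq_ip h (frefl u)) ip_linl; ring.
by have := laplacian_rayleigh hsym hlambda u; rewrite mulrBl; lra.
Qed.
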